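(* Let $q\in(0,1)$, $k\in\mathbb{R}$, let $r,s$ be nonnegative integers and $a_1,\dots,a_r,b_1,\dots,b_s\ge 0$ real numbers. Let $f:(0,\infty)\to(0,\infty)$ satisfy: (i) for all $x>0$, $\displaystyle f(x+1)=\left(\frac{[x+a_1]_q\cdots[x+a_r]_q}{[x+b_1]_q\cdots[x+b_s]_q}\right)^k f(x)$; (ii) there is a constant $M>0$ such that $x\mapsto(1-q)^{k(r-s)x}f(x)$ is monotone for $x>M$; (iii) $f(1)=1$. Then for all $x>0$, $$f(x)=\left(\prod_{i=1}^r\frac{\Gamma_q(x+a_i)}{\Gamma_q(1+a_i)}\prod_{j=1}^s\frac{\Gamma_q(1+b_j)}{\Gamma_q(x+b_j)}\right)^k.$$
   Context: $[x]_q=\frac{1-q^x}{1-q}$. For $0<q<1$ and $x>0$, $\Gamma_q(x)=\frac{(q;q)_\infty}{(q^x;q)_\infty}(1-q)^{1-x}$ with $(a;q)_\infty=\prod_{k=0}^\infty(1-aq^k)$. Empty products equal $1$. *)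

(* Defs.v *)
From HB Require Import structures.
From mathcomp Require Import all_boot all_order all_algebra.
From mathcomp Require Import all_classical all_reals all_analysis.

Set Implicit Arguments.
Unset Strict Implicit.
Unset Printing Implicit Defensive.

Import Order.TTheory GRing.Theory Num.Theory.
Import numFieldNormedType.Exports.

Local Open Scope classical_set_scope.
Local Open Scope ring_scope.

Definition qbracket {R : realType} (q x : R) : R := (1 - q `^ x) / (1 - q).

(* (a; q)_oo; the limit exists for every a when 0 < q < 1. *)
Definition qpochhammer {R : realType} (a q : R) : R :=
  limn (fun n : nat => \prod_(0 <= k < n) (1 - a * q ^+ k)).

(* Meaningful for 0 < q < 1 and 0 < x, where the denominator is nonzero. *)
Definition qGamma {R : realType} (q x : R) : R :=
  qpochhammer q q / qpochhammer (q `^ x) q * (1 - q) `^ (1 - x).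

Definition monotone_on {R : realType} (A : set R) (g : R -> R) : Prop :=
  {in A &, {homo g : x y / x <= y}} \/ {in A &, {homo g : x y /~ x <= y}}.

(* Main.v *)
Require Import Defs.
From mathcomp Require Import all_boot all_order all_algebra.
From mathcomp Require Import all_classical all_reals all_analysis.
From mathcomp Require Import ring lra.

Import Order.TTheory GRing.Theory Num.Theory.
Import numFieldNormedType.Exports.

Local Open Scope classical_set_scope.
Local Open Scope ring_scope.

(* Multiplying f by (1 - q)^(k(r - s)x) turns the recursion into
   h (x + 1) = (prod_i (1 - q^(x+a_i)) / prod_j (1 - q^(x+b_j)))^k h x, so that
   h (x + n) tends to (prod_i (q^(x+a_i); q)_oo / prod_j (q^(x+b_j); q)_oo)^k h x.
   As h is eventually monotone, this limit does not depend on x; comparing it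
   with its value at x = 1 determines h. *)

(** * Convergence and positivity of $q$-Pochhammer symbols *)

Lemma powR_itv01 (R : realType) (q x : R) :
  0 < q -> q < 1 -> 0 < x -> 0 < q `^ x < 1.
Proof.
move=> q0 q1 x0; rewrite powR_gt0 //=.
by rewrite -[ltRHS](congr1 (@^~ x) (@powR1 R)) gt0_ltr_powR ?nnegrE ?ltW.
Qed.

Definition qpochn {R : realType} (q c : R) (n : nat) : R :=
  \prod_(0 <= k < n) (1 - c * q ^+ k).

Section qPochhammer.
Variables (R : realType) (q : R).
Hypotheses (q0 : 0 < q) (q1 : q < 1).

Lemma qpochnS c n : qpochn q c n.+1 = qpochn q c n * (1 - c * q ^+ n).
Proof. by rewrite /qpochn big_nat_recr. Qed.

Section Base01.
Variable c : R.
Hypothesis c01 : 0 < c < 1.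

Lemma qpoch_factor_itv n : 0 < c * q ^+ n <= c.
Proof.
have /andP[c0 c1] := c01; rewrite mulr_gt0 ?exprn_gt0 //=.
by rewrite ger_pMr // exprn_ile1 // ltW.
Qed.

(* [1 / (1 - t) <= expR (t / (1 - t)) <= expR (t / (1 - c))] for [0 < t <= c] *)
Lemma qpochn_ge n : expR (- (c / (1 - c) * ((1 - q ^+ n) / (1 - q)))) <= qpochn q c n.
Proof.
have /andP[c0 c1] := c01.
elim: n => [|n IH]; first by rewrite /qpochn big_nil expr0 subrr mul0r mulr0 oppr0 expR0.
rewrite qpochnS.
have /andP[t0 tc] := qpoch_factor_itv n; set t := c * q ^+ n in t0 tc *.
(* [(1 - q ^+ n) / (1 - q)] is a geometric sum, so the exponent changes by exactly the term
   belonging to the new factor [1 - t]. *)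
have -> : - (c / (1 - c) * ((1 - q ^+ n.+1) / (1 - q))) =
    - (c / (1 - c) * ((1 - q ^+ n) / (1 - q))) + - (t / (1 - c)).
  by rewrite /t exprS; field; rewrite !subr_eq0 (gt_eqF c1) (gt_eqF q1).
rewrite expRD ler_pM ?expR_ge0 // expRN -[leRHS]invrK lef_pV2 ?posrE ?expR_gt0 //;
  last by rewrite invr_gt0; lra.
have -> : (1 - t)^-1 = 1 + t / (1 - t) by field; rewrite subr_eq0 gt_eqF //; lra.
apply: le_trans (expR_ge1Dx _) _; rewrite ler_expR ler_pM2l // lef_pV2 ?posrE; lra.
Qed.

Lemma qpochn_cvg : qpochn q c @ \oo --> qpochhammer c q.
Proof.
apply: nonincreasing_is_cvgn.
  apply/nonincreasing_seqP => n; rewrite qpochnS ler_piMr //.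
    exact: le_trans (expR_ge0 _) (qpochn_ge n).
  by have /andP[/ltW] := qpoch_factor_itv n; rewrite lerBlDr lerDl.
by exists 0 => _ [n _ <-]; exact: le_trans (expR_ge0 _) (qpochn_ge n).
Qed.

Lemma qpochn_gt0 n : 0 < qpochn q c n.
Proof. exact: lt_le_trans (expR_gt0 _) (qpochn_ge n). Qed.

(** Positive partial products alone would only give a nonnegative limit. The geometric sum in
    [qpochn_ge] stays below [(1 - q)^-1], which yields a positive lower bound independent of [n]. *)
Lemma qpochhammer_gt0 : 0 < qpochhammer c q.
Proof.
have /andP[c0 c1] := c01.
apply: lt_le_trans (expR_gt0 (- (c / (1 - c) * (1 - q)^-1))) _.
apply: limr_ge; first exact: qpochn_cvg.
apply: nearW => n; apply: le_trans (qpochn_ge n).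
rewrite ler_expR lerN2 ler_pM2l ?divr_gt0 ?subr_gt0 // ler_pdivrMr ?subr_gt0 //.
by rewrite mulVf ?lerBlDr ?lerDl ?exprn_ge0 ?ltW // gt_eqF // subr_gt0.
Qed.

End Base01.

(** * Quotients of $q$-Gamma values and products of $q$-brackets *)

Lemma qGamma_div x y : 0 < x -> 0 < y ->
  qGamma q x / qGamma q y =
  qpochhammer (q `^ y) q / qpochhammer (q `^ x) q * (1 - q) `^ (y - x).
Proof.
move=> x0 y0.
have q01 : 0 < q < 1 by rewrite q0.
have Pq := qpochhammer_gt0 _ q01.
have Px := qpochhammer_gt0 _ (powR_itv01 _ _ _ q0 q1 x0).
have Py := qpochhammer_gt0 _ (powR_itv01 _ _ _ q0 q1 y0).
have p0 z : 0 < (1 - q) `^ z by rewrite powR_gt0 // subr_gt0.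
have -> : (1 - q) `^ (y - x) = (1 - q) `^ (1 - x) / (1 - q) `^ (1 - y).
  rewrite -powRN -powRD; first by congr (_ `^ _); ring.
  by apply/implyP => _; rewrite gt_eqF // subr_gt0.
rewrite /qGamma; field.
by rewrite !gt_eqF.
Qed.

(** The shifts [c i] cancel in the exponents of [1 - q], so each of the [n] quotients contributes
    the same power. *)
Lemma prod_qGamma_div (n : nat) (c : 'I_n -> R) x y :
  (forall i, 0 <= c i) -> 0 < x -> 0 < y ->
  \prod_(i < n) (qGamma q (x + c i) / qGamma q (y + c i)) =
  \prod_(i < n) qpochhammer (q `^ (y + c i)) q /
  \prod_(i < n) qpochhammer (q `^ (x + c i)) q * (1 - q) `^ ((y - x) * n%:R).
Proof.
move=> c0 x0 y0.
have -> : (1 - q) `^ ((y - x) * n%:R) = \prod_(i < n) (1 - q) `^ (y - x).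
  by rewrite prodr_const card_ord powRrM powR_mulrn ?powR_ge0.
rewrite -prodf_div -big_split; apply: eq_bigr => i _ /=.
by rewrite qGamma_div ?ltr_wpDr // opprD addrACA subrr addr0.
Qed.

Lemma prod_qbracket (n : nat) (y : 'I_n -> R) :
  \prod_(i < n) qbracket q (y i) = \prod_(i < n) (1 - q `^ y i) / (1 - q) ^+ n.
Proof. by rewrite big_split /= prodr_const card_ord exprVn. Qed.

End qPochhammer.

(** * Limits along integer translates, and continuity of real powers *)

Lemma nondecreasing_lim_eq (R : realType) (M : R) (h : R -> R) (x y l m : R) :
  {in [set z | M < z] &, {homo h : u v / u <= v}} ->
  (fun n : nat => h (x + n%:R)) @ \oo --> l ->
  (fun n : nat => h (y + n%:R)) @ \oo --> m -> l = m.
Proof.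
move=> hM.
suff H u v lu lv : (fun n : nat => h (u + n%:R)) @ \oo --> lu ->
    (fun n : nat => h (v + n%:R)) @ \oo --> lv -> lu <= lv.
  by move=> hl hm; apply/le_anti/andP; split; [exact: H hl hm|exact: H hm hl].
(* Delaying the second sequence by [N >= u - v] keeps its limit and gives [u + n <= v + (n + N)];
   both points exceed [M] once [n > M - u], so monotonicity applies. *)
pose N := Num.bound `|u - v|.
move=> hu; rewrite -(cvg_shiftn N) => hv.
apply: ler_cvg_to hu hv _; near=> n.
have uv : u - v <= N%:R.
  by apply: le_trans (ler_norm _) (ltW (archi_boundP (normr_ge0 _))).
have Mn : M - u < n%:R by near: n; exact: nbhs_infty_gtr.
by apply: hM; rewrite ?inE /= ?natrD; lra.
Unshelve. all: by end_near. Qed.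

Lemma monotone_lim_eq (R : realType) (M : R) (h : R -> R) (x y l m : R) :
  monotone_on [set z | M < z] h ->
  (fun n : nat => h (x + n%:R)) @ \oo --> l ->
  (fun n : nat => h (y + n%:R)) @ \oo --> m -> l = m.
Proof.
case=> [hM|hM] hl hm; first exact: nondecreasing_lim_eq hM hl hm.
apply: oppr_inj; apply: (@nondecreasing_lim_eq R M (\- h) x y).
- by move=> u v uM vM uv; rewrite lerN2; exact: hM.
- exact: cvgN hl.
- exact: cvgN hm.
Qed.

(** The real power is defined by cases at 0; near [l > 0] it coincides with [expR (k * ln z)], which
    is continuous there. *)
Lemma cvg_powR (R : realType) (T : Type) (F : set_system T) (FF : Filter F)
    (u : T -> R) (l k : R) :
  0 < l -> u @ F --> l -> (fun t => u t `^ k) @ F --> l `^ k.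
Proof.
move=> l0 ul.
have E : {near nbhs l, (fun z => expR (k * ln z)) =1 (fun z => z `^ k)}.
  near=> z; rewrite /powR gt_eqF //.
  by near: z; exact: lt_nbhsr.
apply: (cvg_comp u (fun z => z `^ k) ul).
have -> : l `^ k = expR (k * ln l) by rewrite /powR gt_eqF.
apply: cvg_trans (near_eq_cvg E) _.
apply: continuous_cvg; first exact: continuous_expR.
by apply: cvgMr; exact: continuous_ln.
Unshelve. all: by end_near. Qed.

(** * Iteration of the normalized recursion and passage to the limit *)

Section NormalizedRecursion.
Variables (R : realType) (q k : R) (r s : nat).
Variables (a : 'I_r -> R) (b : 'I_s -> R) (h : R -> R).
Hypotheses (q0 : 0 < q) (q1 : q < 1).
Hypotheses (a0 : forall i, 0 <= a i) (b0 : forall j, 0 <= b j).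
Hypothesis h_rec : forall x, 0 < x ->
  h (x + 1) = ((\prod_(i < r) (1 - q `^ (x + a i))) /
               (\prod_(j < s) (1 - q `^ (x + b j)))) `^ k * h x.

Definition qpoch_ratio (x : R) : R :=
  (\prod_(i < r) qpochhammer (q `^ (x + a i)) q) /
  (\prod_(j < s) qpochhammer (q `^ (x + b j)) q).

Definition qpochn_ratio (n : nat) (x : R) : R :=
  (\prod_(i < r) qpochn q (q `^ (x + a i)) n) /
  (\prod_(j < s) qpochn q (q `^ (x + b j)) n).

Lemma qpow_shift_itv x c : 0 < x -> 0 <= c -> 0 < q `^ (x + c) < 1.
Proof. by move=> x0 c0; apply: powR_itv01 => //; exact: ltr_wpDr. Qed.

Lemma qpoch_ratio_gt0 x : 0 < x -> 0 < qpoch_ratio x.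
Proof.
by move=> x0; apply: divr_gt0; apply: prodr_gt0 => i _;
  apply: qpochhammer_gt0 => //; exact: qpow_shift_itv.
Qed.

Lemma qpochn_ratio_cvg x : 0 < x -> qpochn_ratio ^~ x @ \oo --> qpoch_ratio x.
Proof.
move=> x0; apply: cvgM; last apply: cvgV.
- apply: cvg_big => [|i _]; first exact: mul_continuous.
  by apply: qpochn_cvg => //; exact: qpow_shift_itv.
- rewrite gt_eqF //; apply: prodr_gt0 => i _.
  by apply: qpochhammer_gt0 => //; exact: qpow_shift_itv.
- apply: cvg_big => [|i _]; first exact: mul_continuous.
  by apply: qpochn_cvg => //; exact: qpow_shift_itv.
Qed.

(** The recursion at [x + n] contributes the factors [1 - q]^ (x + n +
    c)[, and these are the factors]1 - q [^ (x + c) * q ^+ n] that extend each finite symbol from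
    [n] to [n.+1]. *)
Lemma iter_h_rec x n : 0 < x -> h (x + n%:R) = qpochn_ratio n x `^ k * h x.
Proof.
move=> x0; elim: n => [|n IH].
  rewrite addr0 /qpochn_ratio !big1 ?divr1 ?powR1 ?mul1r // => i _;
  by rewrite /qpochn big_nil.
have xn0 : 0 < x + n%:R by rewrite ltr_wpDr.
(* Nonnegativity allows [powRM] to merge the two [k]-th powers into the power of one product. *)
have prod_ge0 m (c : 'I_m -> R) : (forall i, 0 <= c i) ->
    0 <= \prod_(i < m) (1 - q `^ (x + n%:R + c i)).
  move=> c0; apply: prodr_ge0 => i _; rewrite subr_ge0.
  by have /andP[_ /ltW] := qpow_shift_itv _ _ xn0 (c0 i).
have prodS m (c : 'I_m -> R) :
    \prod_(i < m) qpochn q (q `^ (x + c i)) n.+1 =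
    \prod_(i < m) (1 - q `^ (x + n%:R + c i)) *
    \prod_(i < m) qpochn q (q `^ (x + c i)) n.
  rewrite -big_split; apply: eq_bigr => i _ /=; rewrite qpochnS mulrC (addrAC x).
  by rewrite (@powRD _ _ (x + c i)) ?powR_mulrn ?(ltW q0) ?(gt_eqF q0) ?implybT.
rewrite -natr1 addrA h_rec // IH mulrA -powRM ?divr_ge0 ?prod_ge0 //.
- by rewrite /qpochn_ratio !prodS invfM mulrACA.
- by apply: prodr_ge0 => i _; apply/ltW/qpochn_gt0 => //; exact: qpow_shift_itv.
- by apply: prodr_ge0 => i _; apply/ltW/qpochn_gt0 => //; exact: qpow_shift_itv.
Qed.

(** Each side is the limit of [h] along the integer translates of its point, and eventual
    monotonicity forces these limits to agree. *)
Lemma monotone_solution_unique M x y : monotone_on [set z | M < z] h ->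
  0 < x -> 0 < y -> qpoch_ratio x `^ k * h x = qpoch_ratio y `^ k * h y.
Proof.
move=> hM x0 y0.
have h_cvg z : 0 < z ->
    (fun n : nat => h (z + n%:R)) @ \oo --> qpoch_ratio z `^ k * h z.
  move=> z0; under eq_fun do rewrite (iter_h_rec z _ z0).
  apply: cvgM; last exact: cvg_cst.
  by apply: cvg_powR; [exact: qpoch_ratio_gt0|exact: qpochn_ratio_cvg].
exact: monotone_lim_eq hM (h_cvg _ x0) (h_cvg _ y0).
Qed.

End NormalizedRecursion.

(** * Recovering [f] from its normalization [h] *)

Theorem theorem3p4 (R : realType) (q k : R) (r s : nat)
    (a : 'I_r -> R) (b : 'I_s -> R) (f : R -> R)
    (q_gt0 : 0 < q) (q_lt1 : q < 1)
    (a_ge0 : forall i : 'I_r, 0 <= a i) (b_ge0 : forall j : 'I_s, 0 <= b j)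
    (f_gt0 : forall x : R, 0 < x -> 0 < f x)
    (f_rec : forall x : R, 0 < x ->
      f (x + 1) = ((\prod_(i < r) qbracket q (x + a i)) /
                   (\prod_(j < s) qbracket q (x + b j))) `^ k * f x)
    (f_mono : exists M : R, 0 < M /\
      monotone_on [set x : R | M < x]
        (fun x : R => (1 - q) `^ (k * (r%:R - s%:R) * x) * f x))
    (f1 : f 1 = 1) :
  forall x : R, 0 < x ->
    f x = ((\prod_(i < r) (qGamma q (x + a i) / qGamma q (1 + a i))) *
           (\prod_(j < s) (qGamma q (1 + b j) / qGamma q (x + b j)))) `^ k.
Proof.
move=> x x0.
have p0 : 0 < 1 - q by rewrite subr_gt0.
have p_neq0 : 1 - q != 0 by rewrite gt_eqF.
have [M [_ hM]] := f_mono.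
pose e := k * (r%:R - s%:R).
pose h y := (1 - q) `^ (e * y) * f y.
have h_rec (y : R) : 0 < y -> h (y + 1) =
    ((\prod_(i < r) (1 - q `^ (y + a i))) /
     (\prod_(j < s) (1 - q `^ (y + b j)))) `^ k * h y.
  move=> y0; rewrite /h f_rec // !prod_qbracket.
  set A := \prod_(i < r) _; set B := \prod_(j < s) _.
  have AB0 : 0 <= A / B.
    apply: divr_ge0; apply: prodr_ge0 => i _; rewrite subr_ge0.
      by have /andP[_ /ltW] := qpow_shift_itv _ _ q_gt0 q_lt1 _ _ y0 (a_ge0 i).
    by have /andP[_ /ltW] := qpow_shift_itv _ _ q_gt0 q_lt1 _ _ y0 (b_ge0 i).
  (* The denominators of the brackets leave [(1 - q)]^ (s -
     r)[. Its]k[-th power is the inverse of](1 - q) [^ e], the factor that the weight in [h] gains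
     when [y] becomes [y + 1]. *)
  have -> : A / (1 - q) ^+ r / (B / (1 - q) ^+ s) =
      (A / B) * (1 - q) `^ (s%:R - r%:R).
    rewrite powRD ?p_neq0 ?implybT // powRN !powR_mulrn ?(ltW p0) //.
    by rewrite invfM invrK; ring.
  have -> : (A / B * (1 - q) `^ (s%:R - r%:R)) `^ k = (A / B) `^ k / (1 - q) `^ e.
    by rewrite powRM ?powR_ge0 // -powRrM -powRN; congr (_ * _ `^ _); rewrite /e; ring.
  rewrite mulrDr mulr1 powRD ?p_neq0 ?implybT //; field.
  by rewrite gt_eqF // powR_gt0.
have W0 (y : R) (y0 : 0 < y) : 0 < qpoch_ratio R q r s a b y by exact: qpoch_ratio_gt0.
have := monotone_solution_unique _ _ _ _ _ _ _ _ q_gt0 q_lt1 a_ge0 b_ge0 h_rec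
  _ _ _ hM x0 ltr01.
rewrite /h f1 !mulr1 => Wh.
rewrite !prod_qGamma_div // mulrACA.
set p := 1 - q in p0 p_neq0 h hM h_rec Wh *.
have -> : p `^ ((1 - x) * r%:R) * p `^ ((x - 1) * s%:R) =
    p `^ ((r%:R - s%:R) * (1 - x)).
  by rewrite -powRD ?p_neq0 ?implybT //; congr (_ `^ _); ring.
set W := qpoch_ratio R q r s a b in W0 Wh.
set B := _ / _ * (_ / _).
have -> : B = W 1 / W x.
  by rewrite /B /W /qpoch_ratio [in RHS]invfM invrK [RHS]mulrACA; congr (_ * _); exact: mulrC.
have [W1 Wx] := (ltW (W0 _ ltr01), ltW (W0 _ x0)).
have W1x : 0 <= W 1 / W x by exact: divr_ge0.
rewrite (powRM _ W1x) ?powR_ge0 // -powRrM.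
have Wxi : 0 <= (W x)^-1 by rewrite invr_ge0.
rewrite (powRM _ W1 Wxi) -(powR_inv1 Wx) -powRrM mulN1r powRN.
have -> : (r%:R - s%:R) * (1 - x) * k = e - e * x by rewrite /e; ring.
rewrite powRD ?p_neq0 ?implybT // powRN.
have Wx_neq0 : W x `^ k != 0 by rewrite gt_eqF // powR_gt0 // W0.
have pex_neq0 : p `^ (e * x) != 0 by rewrite gt_eqF // powR_gt0.
move: Wh Wx_neq0 pex_neq0.
(* With the powers abstracted, the claim is to solve [u * (Q * F) = v * P] for [F]. *)
move: (W x `^ k) (W 1 `^ k) (p `^ e) (p `^ (e * x)) (f x) => u v P Q F uQF u0 Q0.
have -> : F = u * (Q * F) / (u * Q) by field; rewrite u0 Q0.
by rewrite uQF; field; rewrite u0 Q0.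
Qed.
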